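(* Consider the two-stage mean--CVaR problem described in the context. For fixed first-stage decisions $(\mathbf y,\mathbf W,\nu)$, the second-stage problem $$\min\ (1-\lambda)\sum_{s\in S}p_s(\mathbf y)\,Q_s+\frac{\lambda}{1-\alpha}\sum_{s\in S}p_s(\mathbf y)\,\xi_s$$ over all scenario recourse variables and CVaR excess variables $(\mathbf x^s,\mathbf I^s,\mathbf u^s,\xi_s)_{s\in S}$ is separable across scenarios: its feasible set is the Cartesian product over $s\in S$ of sets constraining only the scenario-$s$ variables $(\mathbf x^s,\mathbf I^s,\mathbf u^s,\xi_s)$, and its objective is a sum over $s\in S$ of functions of the scenario-$s$ variables only. In particular, for each scenario $s\in S$, the associated recourse variables and the CVaR excess variable $\xi_s$ can be optimized independently of all other scenarios: a point $(\mathbf x^s,\mathbf I^s,\mathbf u^s,\xi_s)_{s\in S}$ is optimal for the second-stage problem if and only if, for every $s\in S$, $(\mathbf x^s,\mathbf I^s,\mathbf u^s,\xi_s)$ minimizes $(1-\lambda)p_s(\mathbf y)Q_s+\frac{\lambda}{1-\alpha}p_s(\mathbf y)\xi_s$ subject to the scenario-$s$ constraints.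
   Context: Data. $N$ is a finite set of nodes, $A\subseteq N\times N$ a finite set of directed arcs, $C$ a finite set of commodities, $S$ a finite set of scenarios, $R\subseteq N$ supply nodes, $D\subseteq N$ demand nodes, $\mathcal L$ a finite family of corridors, each corridor $\ell\in\mathcal L$ being a subset of $A$. Parameters: activation costs $f_a$; transport costs $c^s_{ac}$; capacities $\bar u^s_{ac}$; admissibility indicators $\theta^s_{ac}\in\{0,1\}$; demands $d_{ic}$ ($d_{ic}=0$ for $i\notin D$); supplies $r_{ic}$ ($r_{ic}=0$ for $i\notin R$); storage capacities $L_{ic}$; holding costs $h_c$; shortage penalties $\pi_c$; corridor caps $\bar\Phi_\ell$; risk weight $\lambda\in[0,1]$; CVaR level $\alpha\in(0,1)$; baseline probabilities $\bar p_s$ with $\sum_s\bar p_s=1$; shifts $\delta_{sa}\in\mathbb R$. Decision-dependent probabilities: $p_s(\mathbf y)=\bar p_s+\sum_{a\in A}\delta_{sa}y_a$, with $p_s(\mathbf y)\ge0$ for all $s\in S$, $\mathbf y\in\{0,1\}^A$, and $\sum_{s\in S}\delta_{sa}=0$ for all $a\in A$. First-stage variables: $y_a\in\{0,1\}$ ($a\in A$), $0\le W_{ic}\le L_{ic}$ ($i\in N$, $c\in C$), and the CVaR threshold $\nu\in\mathbb R$. The full mean--CVaR problem minimizes $$\sum_{a}f_ay_a+\sum_{i,c}h_cW_{ic}+(1-\lambda)\sum_{s}p_s(\mathbf y)Q_s+\lambda\Big[\nu+\frac1{1-\alpha}\sum_sp_s(\mathbf y)\xi_s\Big].$$ Scenario-$s$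 variables: $\mathbf x^s=(x^s_{ac})\ge0$, $\mathbf I^s=(I^s_{ic})\ge0$, $\mathbf u^s=(u^s_{ic})\ge0$ (with $u^s_{ic}=0$ for $i\notin D$), and $\xi_s$. The scenario-$s$ recourse cost is $$Q_s=\sum_{a\in A}\sum_{c\in C}c^s_{ac}x^s_{ac}+\sum_{i\in N}\sum_{c\in C}h_cI^s_{ic}+\sum_{i\in D}\sum_{c\in C}\pi_cu^s_{ic}.$$ Scenario-$s$ constraints, for all $i\in N$, $a\in A$, $c\in C$, $\ell\in\mathcal L$: (flow balance) $W_{ic}+r_{ic}+\sum_{(j,i)\in A}x^s_{ji,c}-\sum_{(i,j)\in A}x^s_{ij,c}-d_{ic}+u^s_{ic}=I^s_{ic}$; (capacity and admissibility) $x^s_{ac}\le\theta^s_{ac}\bar u^s_{ac}y_a$; (storage) $I^s_{ic}\le L_{ic}$; (corridor cap) $\sum_{a\in\ell}\sum_{c\in C}x^s_{ac}\le\bar\Phi_\ell\sum_{a\in A}\sum_{c\in C}x^s_{ac}$; (CVaR excess) $\xi_s\ge Q_s-\nu$, $\xi_s\ge0$. *)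

(* Defs.v *)
From HB Require Import structures.
From mathcomp Require Import all_boot all_order all_algebra.
From mathcomp Require Import classical_sets reals.
From mathcomp Require Import ring.

Set Implicit Arguments.
Unset Strict Implicit.
Unset Printing Implicit Defensive.

Import Order.TTheory GRing.Theory Num.Theory.
Local Open Scope classical_set_scope.
Local Open Scope ring_scope.

(* An arc [a] of [A] has tail [(val a).1] and head [(val a).2]. *)
Notation arc A := {a | a \in A}.

(* [N], [C], [S] and [K] are the nodes, the commodities, the scenarios and the
   index set of the family of corridors. *)
Record problem (R : realType) (N C S K : finType) (A : {set N * N}) := Problem {
  supply_nodes : {set N};
  demand_nodes : {set N};
  corridor : K -> {set arc A};
  activation_cost : arc A -> R;
  transport_cost : S -> arc A -> C -> R;
  arc_capacity : S -> arc A -> C -> R;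
  admissible : S -> arc A -> C -> bool;
  demand : N -> C -> R;
  supply : N -> C -> R;
  storage_capacity : N -> C -> R;
  holding_cost : C -> R;
  shortage_penalty : C -> R;
  corridor_cap : K -> R;
  risk_weight : R;
  cvar_level : R;
  baseline_prob : S -> R;
  prob_shift : S -> arc A -> R
}.

Record first_stage (R : realType) (N C : finType) (A : {set N * N}) :=
  FirstStage {
    activation : {ffun arc A -> bool};
    prepositioned : N -> C -> R;
    threshold : R
  }.

(* The tuple (x^s, I^s, u^s, xi_s) of one scenario. *)
Record scenario_vars (R : realType) (N C : finType) (A : {set N * N}) :=
  ScenarioVars {
    flow : arc A -> C -> R;
    inventory : N -> C -> R;
    shortage : N -> C -> R;
    excess : R
  }.

Definition is_minimizer (R : realType) (T : Type) (F : set T) (g : T -> R)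
    (z : T) : Prop :=
  F z /\ forall w, F w -> g z <= g w.

Section Model.
Variables (R : realType) (N C S K : finType) (A : {set N * N}).
Variable P : problem R C S K A.

Definition scenario_prob (y : {ffun arc A -> bool}) (s : S) : R :=
  baseline_prob P s + \sum_(a : arc A) prob_shift P s a * (y a)%:R.

Record valid_problem : Prop := ValidProblem {
  demand_out : forall i c, i \notin demand_nodes P -> demand P i c = 0;
  supply_out : forall i c, i \notin supply_nodes P -> supply P i c = 0;
  risk_weight_itv : 0 <= risk_weight P <= 1;
  cvar_level_itv : 0 < cvar_level P < 1;
  baseline_prob_sum : \sum_(s : S) baseline_prob P s = 1;
  scenario_prob_ge0 : forall s y, 0 <= scenario_prob y s;
  prob_shift_sum : forall a, \sum_(s : S) prob_shift P s a = 0
}.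

Definition first_stage_feasible (v : first_stage R C A) : Prop :=
  forall i c, 0 <= prepositioned v i c <= storage_capacity P i c.

Definition inflow (x : arc A -> C -> R) (i : N) (c : C) : R :=
  \sum_(a : arc A | (val a).2 == i) x a c.

Definition outflow (x : arc A -> C -> R) (i : N) (c : C) : R :=
  \sum_(a : arc A | (val a).1 == i) x a c.

Definition recourse_cost (s : S) (w : scenario_vars R C A) : R :=
  \sum_(a : arc A) \sum_(c : C) transport_cost P s a c * flow w a c
  + \sum_(i : N) \sum_(c : C) holding_cost P c * inventory w i c
  + \sum_(i in demand_nodes P) \sum_(c : C) shortage_penalty P c * shortage w i c.

Variable v : first_stage R C A.
Let y := activation v.
Let W := prepositioned v.
Let nu := threshold v.

Record second_stage_constraints (z : S -> scenario_vars R C A) : Prop :=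
  SecondStageConstraints {
    flows_ge0 : forall s a c, 0 <= flow (z s) a c;
    inventories_ge0 : forall s i c, 0 <= inventory (z s) i c;
    shortages_ge0 : forall s i c, 0 <= shortage (z s) i c;
    shortages_out : forall s i c,
      i \notin demand_nodes P -> shortage (z s) i c = 0;
    flow_balances : forall s i c,
      W i c + supply P i c + inflow (flow (z s)) i c - outflow (flow (z s)) i c
      - demand P i c + shortage (z s) i c = inventory (z s) i c;
    capacities : forall s a c,
      flow (z s) a c <= (admissible P s a c)%:R * arc_capacity P s a c * (y a)%:R;
    storages : forall s i c, inventory (z s) i c <= storage_capacity P i c;
    corridor_caps : forall s l,
      \sum_(a in corridor P l) \sum_(c : C) flow (z s) a c
      <= corridor_cap P l * \sum_(a : arc A) \sum_(c : C) flow (z s) a c;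
    excesses_ge : forall s, recourse_cost s (z s) - nu <= excess (z s);
    excesses_ge0 : forall s, 0 <= excess (z s)
  }.

Definition second_stage_feasible : set (S -> scenario_vars R C A) :=
  [set z | second_stage_constraints z].

Definition second_stage_objective (z : S -> scenario_vars R C A) : R :=
  (1 - risk_weight P) * \sum_(s : S) scenario_prob y s * recourse_cost s (z s)
  + risk_weight P / (1 - cvar_level P)
    * \sum_(s : S) scenario_prob y s * excess (z s).

Record scenario_constraints (s : S) (w : scenario_vars R C A) : Prop :=
  ScenarioConstraints {
    flow_ge0 : forall a c, 0 <= flow w a c;
    inventory_ge0 : forall i c, 0 <= inventory w i c;
    shortage_ge0 : forall i c, 0 <= shortage w i c;
    shortage_out : forall i c, i \notin demand_nodes P -> shortage w i c = 0;
    flow_balance : forall i c,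
      W i c + supply P i c + inflow (flow w) i c - outflow (flow w) i c
      - demand P i c + shortage w i c = inventory w i c;
    capacity : forall a c,
      flow w a c <= (admissible P s a c)%:R * arc_capacity P s a c * (y a)%:R;
    storage : forall i c, inventory w i c <= storage_capacity P i c;
    corridor_capped : forall l,
      \sum_(a in corridor P l) \sum_(c : C) flow w a c
      <= corridor_cap P l * \sum_(a : arc A) \sum_(c : C) flow w a c;
    excess_ge : recourse_cost s w - nu <= excess w;
    excess_ge0 : 0 <= excess w
  }.

Definition scenario_feasible (s : S) : set (scenario_vars R C A) :=
  [set w | scenario_constraints s w].

Definition scenario_objective (s : S) (w : scenario_vars R C A) : R :=
  (1 - risk_weight P) * scenario_prob y s * recourse_cost s w
  + risk_weight P / (1 - cvar_level P) * scenario_prob y s * excess w.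

Definition first_stage_cost : R :=
  \sum_(a : arc A) activation_cost P a * (y a)%:R
  + \sum_(i : N) \sum_(c : C) holding_cost P c * W i c.

Definition full_objective (z : S -> scenario_vars R C A) : R :=
  first_stage_cost
  + (1 - risk_weight P) * \sum_(s : S) scenario_prob y s * recourse_cost s (z s)
  + risk_weight P
    * (nu + (1 - cvar_level P)^-1 * \sum_(s : S) scenario_prob y s * excess (z s)).

(* Once the first stage is fixed, the full mean-CVaR objective and the
   second-stage objective differ by a constant. *)
Lemma full_objectiveE (z : S -> scenario_vars R C A) :
  full_objective z =
  first_stage_cost + risk_weight P * nu + second_stage_objective z.
Proof. rewrite /full_objective /second_stage_objective; ring. Qed.

End Model.

(* Main.v *)
Require Import Defs.
From HB Require Import structures.
From mathcomp Require Import all_boot all_order all_algebra.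
From mathcomp Require Import classical_sets reals.

Set Implicit Arguments.
Unset Strict Implicit.
Unset Printing Implicit Defensive.

Import Order.TTheory GRing.Theory Num.Theory.
Local Open Scope classical_set_scope.
Local Open Scope ring_scope.

(** Scenarios interact only through [y], [W] and [nu]. Once these are fixed, each probability is a
    constant and each constraint mentions a single scenario, so the problem minimizes a sum of
    functions of separate coordinates over a product of sets. [second_stage_feasibleE] and
    [second_stage_objectiveE] exhibit this form; [is_minimizer_sum_prod] decouples it. *)

(* For the direct implication, replace a single coordinate of an optimal point by
   a feasible competitor: all the other summands cancel. *)
Lemma is_minimizer_sum_prod (R : realType) (S : finType) (T : Type)
    (F : S -> set T) (g : S -> T -> R) (z : S -> T) :
  is_minimizer [set z : S -> T | forall s, F s (z s)]
    (fun z => \sum_(s : S) g s (z s)) z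
  <-> forall s, is_minimizer (F s) (g s) (z s).
Proof.
split=> [[Fz minz] s | minz]; last first.
  (* Converse: the coordinatewise inequalities add up. *)
  split=> [s | w Fw]; first by case: (minz s).
  by apply: ler_sum => s _; case: (minz s) => _; apply; apply: Fw.
split=> [|w Fw]; first exact: Fz.
pose z' t := if t == s then w else z t.
have Fz' t : F t (z' t) by rewrite /z'; case: eqP => [->|_] //; apply: Fz.
have := minz _ Fz'; rewrite (bigD1 s) // [leRHS](bigD1 s) //= /z' eqxx.
rewrite [X in _ <= _ + X](eq_bigr (fun t => g t (z t))); last first.
  by move=> t /negPf ->.
by rewrite lerD2r.
Qed.

Lemma second_stage_feasibleE (R : realType) (N C S K : finType)
    (A : {set N * N}) (P : problem R C S K A) (v : first_stage R C A) :
  second_stage_feasible P v =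
  [set z : S -> scenario_vars R C A | forall s, scenario_feasible P v s (z s)].
Proof.
apply/seteqP; split=> [z [? ? ? ? ? ? ? ? ? ?] s | z Fz]; first by split; auto.
by split=> s; case: (Fz s).
Qed.

(** With [v] fixed, the decision-dependent probabilities are mere coefficients, so the risk weights
    distribute over the sums. *)
Lemma second_stage_objectiveE (R : realType) (N C S K : finType)
    (A : {set N * N}) (P : problem R C S K A) (v : first_stage R C A)
    (z : S -> scenario_vars R C A) :
  second_stage_objective P v z = \sum_(s : S) scenario_objective P v s (z s).
Proof.
rewrite /second_stage_objective !mulr_sumr -big_split /=.
by apply: eq_bigr => s _; rewrite !mulrA.
Qed.

Theorem proposition2 (R : realType) (N C S K : finType) (A : {set N * N})
    (P : problem R C S K A) (hP : valid_problem P)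
    (v : first_stage R C A) (hv : first_stage_feasible P v) :
  [/\ second_stage_feasible P v =
        [set z : S -> scenario_vars R C A |
          forall s : S, scenario_feasible P v s (z s)],
      forall z : S -> scenario_vars R C A,
        second_stage_objective P v z =
        \sum_(s : S) scenario_objective P v s (z s)
    & forall z : S -> scenario_vars R C A,
        is_minimizer (second_stage_feasible P v) (second_stage_objective P v) z
        <-> forall s : S,
              is_minimizer (scenario_feasible P v s) (scenario_objective P v s)
                (z s)].
Proof.
split=> [|z|z]; first exact: second_stage_feasibleE.
  exact: second_stage_objectiveE.
(* The objectives are known to agree pointwise, so [is_minimizer] is unfolded to rewrite at [z] and
   at each competitor [w]. *)
rewrite second_stage_feasibleE -is_minimizer_sum_prod /is_minimizer.
by split=> -[Fz minz]; split=> // w Fw; have := minz w Fw;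
  rewrite !second_stage_objectiveE.
Qed.
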